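(* Let $G$ be a $(v,k,\lambda)_0$ relative skew Hadamard difference set group with difference set $D$ and subgroup $H$, and let $h=|H|$. Then the minimal polynomial for $D$ is $$\mu(D)=(x-k)\left(x+\frac h2\right)\left(x^2+\frac{h^2}{4}\right).$$ Further, the eigenvalues $k,\ -h/2,\ ih/2,\ -ih/2$ have multiplicities $$1,\quad h-1,\quad h(h-1)/2,\quad h(h-1)/2$$ respectively, where $i^2=-1$.
   Context: A $(v,k,\lambda)$ difference set is a subset $D\subset G$ with $|D|=k$, where $G$ is a finite group with $|G|=v$, such that every element $1\neq g\in G$ occurs $\lambda$ times in the multiset $\{xy^{-1}:x,y\in D\}$. For $X\subseteq G$ write $X^{-1}=\{x^{-1}:x\in X\}$. A finite group $G$ is a $(v,k,\lambda)_0$ relative skew Hadamard difference set group with difference set $D$ and subgroup $H$ if $D\subset G$ is a $(v,k,\lambda)$ difference set, $1\ne H\le G$, $D\cap D^{-1}=\emptyset$ and $G\setminus(D\cup D^{-1})=H$. $D$ is identified with the element $\sum_{d\in D}d$ of the group algebra, and is regarded as a $|G|\times|G|$ matrix via the regular representation of $G$; minimal polynomial, eigenvalues and multiplicities refer to this matrix.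
   Formalization: The difference set D is assumed nonempty: for D empty, H = G ≠ 1 and k = λ = 0 the definition is satisfied literally, but the matrix of D is 0 with minimal polynomial x, so the claim fails. *)

(* Defs.v *)
From HB Require Import structures.
From mathcomp Require Import all_boot all_order all_algebra all_fingroup.
From mathcomp Require Import all_solvable all_field all_character.

Set Implicit Arguments.
Unset Strict Implicit.
Unset Printing Implicit Defensive.

Import GroupScope.

Section RelativeSkewHadamard.

Variable gT : finGroupType.
Implicit Types (G H : {group gT}) (D : {set gT}).

Definition difference_set (v k lambda : nat) G D : Prop :=
  [/\ #|G| = v, D \subset G, #|D| = k
    & forall g, g \in G -> g != 1 ->
      #|[set p in setX D D | p.1 * p.2^-1 == g]| = lambda].

(* The case D = set0, H = G (with k = lambda = 0) is not excluded here. *)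
Definition relative_skew_hadamard (v k lambda : nat) G D H : Prop :=
  [/\ difference_set v k lambda G D, H \subset G, H :!=: 1,
      D :&: D^-1 = set0 & G :\: (D :|: D^-1) = H].

End RelativeSkewHadamard.

(* [gset_mx C G D] is the sum over D of the regular representation matrices;
   the cast makes its size syntactically positive, as [mxminpoly] requires. *)
Definition regular_sum_mx (C : fieldType) (gT : finGroupType)
    (G : {group gT}) (D : {set gT}) : 'M[C]_(#|G|.-1.+1) :=
  let eG := esym (prednK (cardG_gt0 G)) in castmx (eG, eG) (gset_mx C G D).

(* Main.v *)
Require Import Defs.
From mathcomp Require Import all_boot all_order all_algebra all_fingroup.
From mathcomp Require Import all_solvable all_field all_character.
From mathcomp Require Import zify ring.

(** Let M, N, J be the sums of the regular representation over D, H and G.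
Inverting a set transposes its matrix, so the hypotheses read
[M + M^T + N = J] and [M M^T = (k - lambda) + lambda J].  As [M] commutes
with [M^T] and with [J], it commutes with [N] ([skew_mx_normal],
[skew_mx_comm]).

Comparing multiples of [J] gives [v = 2k + h] and
[k^2 = k + lambda (v - 1)]; hence [v - 1] divides [h^2 - 1].  Since [h] divides
[v], the quotient is congruent to 1 modulo [h], and [v > h] leaves only the
quotient 1: so [v = h^2], [k = h (h - 1) / 2] and [k - lambda = (h / 2)^2]
([order_eq_sqr], [skew_mx_params]).

Put [c = h / 2].  Geometrically, D meets every coset of H other than H itself
in exactly [c] points, that is [M N = c (J - N)] ([skew_mx_MN]): the real matrix
measuring the defect has zero product with its transpose once the values of the
parameters are used.  Together with [M^2 + c^2 = M (M + M^T) - lambda J]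
this shows that [(M + c) (M^2 + c^2)] is a multiple of [J], and [M - k]
annihilates [J] ([skew_mx_annihilator]).

The annihilating polynomial has the four distinct roots [k, -c, ic, -ic], so
[M] is diagonalizable and the trace of [q(M)] is the sum of the [q(a)] weighted
by the multiplicities ([mxtrace_horner_mup]).  Neither D nor D D contains the
identity, so [tr M = tr M^2 = 0]; with [tr 1 = h^2], and separating real and
imaginary parts, this determines all four multiplicities ([multiplicities]).
They are positive, so every root occurs in the minimal polynomial. *)

Set Implicit Arguments.
Unset Strict Implicit.
Unset Printing Implicit Defensive.

Import Order.TTheory GRing.Theory Num.Theory.
Local Open Scope ring_scope.

(** * Group sums in the regular representation *)

Section GroupSums.

Variables (C : fieldType) (gT : finGroupType) (G : {group gT}).
Implicit Types (A B D : {set gT}) (K : {group gT}).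
Local Notation aG := (regular_repr C G).
Local Notation sum_mx := (gset_mx C G).

Lemma regular_mxE x (i j : 'I_#|G|) :
  x \in G -> aG x i j = (enum_val j == enum_val i * x)%g%:R.
Proof.
move=> Gx; rewrite /= mxE mxE eqxx /=; congr (_%:R).
have Gix : (enum_val i * x)%g \in G by rewrite groupM ?enum_valP.
by rewrite -(inj_eq enum_val_inj) gring_indexK.
Qed.

Lemma trmx_regular x : x \in G -> (aG x)^T = aG x^-1%g.
Proof.
move=> Gx; apply/matrixP=> i j; rewrite mxE !regular_mxE ?groupV //.
by rewrite eq_sym (can2_eq (mulgK x) (mulgKV x)).
Qed.

Lemma mxtrace_regular x : x \in G -> \tr (aG x) = #|G|%:R *+ (x == 1%g).
Proof.
move=> Gx; have [->|x1] := eqVneq; first by rewrite repr_mx1 mxtrace1.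
rewrite /mxtrace big1 // => i _; rewrite regular_mxE //.
by rewrite -[X in X == _]mulg1 (inj_eq (mulgI _)) eq_sym (negPf x1).
Qed.

Lemma trmx_gset A : A \subset G -> (sum_mx A)^T = sum_mx A^-1%g.
Proof.
move=> sAG; rewrite /gset_mx raddf_sum /=.
rewrite (reindex_inj invg_inj) /=; apply: eq_big => [x|x Ax].
  by rewrite mem_invg.
by rewrite trmx_regular ?invgK ?(subsetP sAG).
Qed.

Lemma mxtrace_gset A : A \subset G ->
  \tr (sum_mx A) = #|G|%:R *+ (1%g \in A).
Proof.
move=> sAG; rewrite /gset_mx raddf_sum /=.
rewrite (eq_bigr (fun x => #|G|%:R *+ (x == 1%g))); last first.
  by move=> x Ax; rewrite mxtrace_regular ?(subsetP sAG).
have [A1|A1] := boolP (1%g \in A); last first.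
  by rewrite big1 // => x Ax; case: eqP Ax A1 => // -> ->.
by rewrite (bigD1 1%g) //= eqxx big1 ?addr0 // => x /andP[_ /negPf->].
Qed.

Lemma mulmx_gset A B : A \subset G -> B \subset G ->
  sum_mx A *m sum_mx B = \sum_(x in A) \sum_(y in B) aG (x * y)%g.
Proof.
move=> sAG sBG; rewrite /gset_mx mulmx_suml; apply: eq_bigr => x Ax.
rewrite mulmx_sumr; apply: eq_bigr => y By.
by rewrite repr_mxM //; [apply: subsetP Ax | apply: subsetP By].
Qed.

(** Each [x] in [A] permutes [K] by translation and thus contributes one copy of
the sum over [K]. *)
Lemma mulmx_gset_group A K : A \subset K -> K \subset G ->
  sum_mx A *m sum_mx K = #|A|%:R *: sum_mx K.
Proof.
move=> sAK sKG; rewrite mulmx_gset ?(subset_trans sAK) //.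
rewrite scaler_nat -sumr_const; apply: eq_bigr => x Ax.
rewrite [RHS](reindex_inj (mulgI x)); apply: eq_bigl => y.
by rewrite groupMl ?(subsetP sAK _ Ax).
Qed.

Lemma mulmx_group_gset A K : A \subset K -> K \subset G ->
  sum_mx K *m sum_mx A = #|A|%:R *: sum_mx K.
Proof.
move=> sAK sKG; rewrite mulmx_gset ?(subset_trans sAK) // exchange_big /=.
rewrite scaler_nat -sumr_const; apply: eq_bigr => x Ax.
rewrite [RHS](reindex_inj (mulIg x)); apply: eq_bigl => y.
by rewrite groupMr ?(subsetP sAK _ Ax).
Qed.

(** Group the pairs of elements of [D] by their quotient: the identity is
obtained [k] times, on the diagonal, and any other element [lambda] times. *)
Lemma difference_set_mx v k lambda D : difference_set v k lambda G D ->
  sum_mx D *m sum_mx D^-1%g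
    = (k%:R - lambda%:R)%:M + lambda%:R *: sum_mx G.
Proof.
case=> _ sDG Dk Dlambda; rewrite mulmx_gset //; last by rewrite -(invGid G) invSg.
have quotG p : p \in setX D D -> (p.1 * p.2^-1)%g \in G.
  case: p => x y; rewrite in_setX => /andP[Dx Dy].
  by rewrite groupM ?groupV ?(subsetP sDG).
under eq_bigr => x _ do rewrite (reindex_inj invg_inj) /=.
rewrite pair_big /=.
under eq_bigl => p do rewrite mem_invg invgK -in_setX -surjective_pairing.
rewrite (partition_big (fun p => p.1 * p.2^-1)%g (mem G)) //=.
have coef g : \sum_(p in setX D D | (p.1 * p.2^-1)%g == g) aG (p.1 * p.2^-1)%g
    = #|[set p in setX D D | (p.1 * p.2^-1)%g == g]|%:R *: aG g.
  rewrite scaler_nat -sumr_const; under [RHS]eq_bigl => p do rewrite inE.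
  by apply: eq_bigr => p /andP[_ /eqP->].
under eq_bigr => g _ do rewrite coef.
rewrite /gset_mx (bigD1 1%g) //= [in RHS](bigD1 1%g) //= repr_mx1.
have -> : #|[set p in setX D D | (p.1 * p.2^-1)%g == 1%g]| = k.
  rewrite -Dk -[RHS](card_imset _ (f := fun x => (x, x))) => [|x y [] //].
  apply: eq_card => -[x y]; rewrite !inE /= -eq_mulgV1.
  apply/andP/imsetP => [[/andP[Dx _] /eqP<-]|[z Dz [-> ->]]]; first by exists x.
  by rewrite Dz.
under eq_bigr => g /andP[Gg g1] do rewrite Dlambda //.
rewrite -scaler_sumr scalerDr addrA; congr (_ + _).
by rewrite !scalemx1 -raddfD /= subrK.
Qed.

End GroupSums.

(** * The order of the group *)

(** Modulo [h] the hypothesis says [-1 = -q], so [q = 1 + h t]; for [t >= 1] the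
right-hand side would be at least [(h + 1)^2], which is too large. *)
Lemma eq_sqr_of_pred_dvd (h m q : int) :
    2 <= h -> h + 2 <= m * h -> h ^+ 2 - 1 = (m * h - 1) * q ->
  m * h = h ^+ 2.
Proof.
move=> h2 hn qE.
have q0 : 0 < q by rewrite -(pmulr_rgt0 q (x := m * h - 1)) -?qE; nia.
have [t tE] : exists t, q = 1 + h * t.
  exists (q * m - h).
  have qN : q = m * h * q - (h ^+ 2 - 1) by rewrite qE; ring.
  by rewrite [LHS]qN; ring.
have t0 : 0 <= t by nia.
have t1 : t <= 0.
  rewrite leNgt; apply/negP=> t1.
  have : (h + 1) * (h + 1) <= (m * h - 1) * q by apply: ler_pM; nia.
  by rewrite -qE; nia.
have t00 : t = 0 by lia.
by rewrite -[RHS](subrK 1) qE tE t00; ring.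
Qed.

(** From [4 lambda (n - 1) = (n - h) (n - h - 2)], which is
[(n - 1) (n - 1 - 2 h) + h^2 - 1], the number [n - 1] divides [h^2 - 1]. *)
Lemma order_eq_sqr (n k lambda h : nat) :
    (1 < h)%N -> (0 < k)%N -> (h %| n)%N -> n = (k.*2 + h)%N ->
    (k ^ 2 + lambda = k + lambda * n)%N ->
  (n = h ^ 2)%N.
Proof.
move=> h1 k0 /dvdnP[m nE] n2k k2.
apply/eqP; rewrite -eqz_nat nE PoszM -mulnn PoszM -expr2; apply/eqP.
apply: (@eq_sqr_of_pred_dvd _ _ (4 * lambda%:Z - n%:Z + 1 + 2 * h%:Z)).
- lia.
- by rewrite -PoszM -nE; lia.
rewrite -PoszM -nE.
have k2Z : k%:Z ^+ 2 + lambda%:Z = k%:Z + lambda%:Z * n%:Z.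
  by rewrite -PoszM -!PoszD -k2.
have -> : h%:Z = n%:Z - 2 * k%:Z by lia.
(* Isolate [k + lambda * n], so that the counting relation can be used. *)
rewrite [RHS](_ : _ = 4 * (k%:Z + lambda%:Z * n%:Z) - 4 * lambda%:Z - 4 * k%:Z
                - n%:Z * (n%:Z - 2) - 1 + (n%:Z - 1) * 2 * (n%:Z - 2 * k%:Z)).
  by rewrite -k2Z; ring.
by ring.
Qed.

(** * Matrix relations of a relative skew Hadamard difference set *)

(** The facts about the matrices of [D], [H] and [G] from which the spectrum is
computed.  They refer to an arbitrary size [n], so that they can be transported
along an equality of sizes, and they no longer mention the group. *)
Record relative_skew_mx (C : numClosedFieldType) (n k lambda h : nat)
    (M N J : 'M[C]_n) : Prop := RelativeSkewMx {
  rsm_sum : J = M + M^T + N;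
  rsm_diff : M *m M^T = (k%:R - lambda%:R)%:M + lambda%:R *: J;
  rsm_MJ : M *m J = k%:R *: J;
  rsm_JM : J *m M = k%:R *: J;
  rsm_NJ : N *m J = h%:R *: J;
  rsm_JN : J *m N = h%:R *: J;
  rsm_NN : N *m N = h%:R *: N;
  rsm_JJ : J *m J = n%:R *: J;
  rsm_trJ : J^T = J;
  rsm_trN : N^T = N;
  rsm_M_real : forall i j, M i j \is Num.real;
  rsm_N_real : forall i j, N i j \is Num.real;
  rsm_traceJ : \tr J = n%:R;
  rsm_trace : \tr M = 0;
  rsm_trace_sqr : \tr (M *m M) = 0
}.

(** The traces vanish because the identity lies in [H], hence not in [D], and
because [D] contains no element together with its inverse. *)
Lemma relative_skew_gset_mx (C : numClosedFieldType) (gT : finGroupType)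
    (G H : {group gT}) (D : {set gT}) (v k lambda : nat) :
    relative_skew_hadamard v k lambda G D H ->
  relative_skew_mx k lambda #|H| (gset_mx C G D) (gset_mx C G H) (gset_mx C G G).
Proof.
case=> Ddiff sHG _ disjD GDH; have [_ sDG Dk _] := Ddiff.
have sVG : D^-1%g \subset G by rewrite -(invGid G) invSg.
have D'H x : x \in D -> x \notin H by move=> Dx; rewrite -GDH !inE Dx.
have D'1 : 1%g \notin D by apply/negP=> /D'H; rewrite group1.
have D'V x : x \in D -> (x^-1)%g \notin D.
  move=> Dx; rewrite -mem_invg; apply/negP=> Vx.
  by have := in_set0 x; rewrite -disjD inE Dx Vx.
have gset_real (A : {set gT}) i j : A \subset G -> gset_mx C G A i j \is Num.real.
  move=> sAG; rewrite /gset_mx summxE rpred_sum // => x Ax.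
  by rewrite regular_mxE ?realn ?(subsetP sAG).
split.
- rewrite trmx_gset // /gset_mx (bigID (mem D)) /=.
  rewrite (bigID (mem D^-1%g) (fun x => (x \in G) && (x \notin D))) /= addrA.
  congr (_ + _ + _); apply: eq_bigl => x.
  + by rewrite andb_idl // => /(subsetP sDG).
  + rewrite andb_idl // => Vx; rewrite (subsetP sVG) //=.
    by apply/negP=> /D'V; rewrite -mem_invg Vx.
  + by rewrite -GDH !inE negb_or [RHS]andbC andbA.
- by rewrite trmx_gset //; apply: difference_set_mx Ddiff.
- by rewrite mulmx_gset_group ?Dk.
- by rewrite mulmx_group_gset ?Dk.
- by rewrite mulmx_gset_group.
- by rewrite mulmx_group_gset.
- by rewrite mulmx_gset_group.
- by rewrite mulmx_gset_group.
- by rewrite trmx_gset // invGid.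
- by rewrite trmx_gset // invGid.
- by move=> i j; apply: gset_real.
- by move=> i j; apply: gset_real.
- by rewrite mxtrace_gset // group1.
- by rewrite mxtrace_gset // (negPf D'1).
rewrite mulmx_gset // raddf_sum big1 // => x Dx.
rewrite raddf_sum big1 // => y Dy /=.
rewrite mxtrace_regular ?groupM ?(subsetP sDG) //.
by rewrite -eq_invg_mul; have := D'V x Dx; case: eqP => // ->; rewrite Dy.
Qed.

Lemma relative_skew_mx_cast (C : numClosedFieldType) (n m k lambda h : nat)
    (e : n = m) (M N J : 'M[C]_n) :
  relative_skew_mx k lambda h M N J ->
  relative_skew_mx k lambda h (castmx (e, e) M) (castmx (e, e) N) (castmx (e, e) J).
Proof. by case: m / e; rewrite !castmx_id. Qed.

(** * Consequences of the matrix relations *)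

(** A diagonal entry of [X *m X^T] is the sum of the squares of a row of [X]. *)
Lemma trmx_sqr_eq0 (C : numDomainType) (m n : nat) (X : 'M[C]_(m, n)) :
  (forall i j, X i j \is Num.real) -> X *m X^T = 0 -> X = 0.
Proof.
move=> Xreal XX; apply/matrixP=> i j; rewrite mxE.
have /eqP := congr1 (fun Y : 'M_m => Y i i) XX; rewrite !mxE psumr_eq0 /=.
  move=> /allP/(_ j (mem_index_enum _)); rewrite mxE mulf_eq0 orbb => /eqP //.
by move=> l _; rewrite mxE -expr2 real_exprn_even_ge0.
Qed.

Section RelativeSkewMatrices.

Variables (C : numClosedFieldType) (n k lambda h : nat) (M N J : 'M[C]_n).
Hypothesis MNJ : relative_skew_mx k lambda h M N J.
Hypotheses (n0 : (0 < n)%N) (h1 : (1 < h)%N) (k0 : (0 < k)%N) (hn : (h %| n)%N).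

Let J0 (a : C) : a *: J = 0 -> a = 0.
Proof.
move=> /(congr1 mxtrace)/eqP; rewrite mxtraceZ mxtrace0 (rsm_traceJ MNJ).
by rewrite mulf_eq0 pnatr_eq0 eqn0Ngt n0 orbF => /eqP.
Qed.

Let JMt : J *m M^T = k%:R *: J.
Proof.
by rewrite -{1}(rsm_trJ MNJ) -trmx_mul (rsm_MJ MNJ) linearZ /= (rsm_trJ MNJ).
Qed.

(** Both [J *m J] and [J *m (M *m M^T)] are multiples of [J] that can be computed
in two ways. *)
Lemma skew_mx_params :
  [/\ n = h ^ 2, k.*2 = h * (h - 1) & 4 * lambda = h * (h - 2)]%N.
Proof.
have n2k : n = (k.*2 + h)%N.
  have : (n%:R - (k%:R + k%:R + h%:R)) *: J = 0.
    rewrite scalerBl -(rsm_JJ MNJ) {2}(rsm_sum MNJ) !mulmxDr.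
    by rewrite (rsm_JM MNJ) (rsm_JN MNJ) JMt -!scalerDl subrr.
  move/J0/eqP; rewrite subr_eq0 -!natrD eqr_nat => /eqP->; lia.
have k2 : (k ^ 2 + lambda = k + lambda * n)%N.
  have : (k%:R ^+ 2 - (k%:R - lambda%:R + lambda%:R * n%:R)) *: J = 0.
    rewrite scalerBl expr2 -scalerA -JMt scalemxAl -(rsm_JM MNJ) -mulmxA.
    rewrite (rsm_diff MNJ) mulmxDr mul_mx_scalar -scalemxAr (rsm_JJ MNJ).
    by rewrite scalerA -scalerDl subrr.
  move/J0/eqP; rewrite subr_eq0 -natrX => /eqP k2.
  apply/eqP; rewrite -(eqr_nat C) !natrD natrM k2; apply/eqP; ring.
have nE := order_eq_sqr h1 k0 hn n2k k2.
have kE : (k.*2 = h * (h - 1))%N by nia.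
(* [lambda * (h ^ 2 - 1) = k * (k - 1)], and [h ^ 2 - 1] can be cancelled. *)
split=> //; apply/eqP; rewrite -(eqn_pmul2r (m := (h - 1) * (h + 1))); last by lia.
have [g hE] : exists g, h = (g + 2)%N by exists (h - 2)%N; lia.
have {}kE : (2 * k = (g + 2) * (g + 1))%N by rewrite mul2n kE hE; congr (_ * _)%N; lia.
have k4 : (2 * k * (2 * k) + 4 * lambda = 2 * (2 * k) + 4 * lambda * h ^ 2)%N by nia.
rewrite kE hE in k4; rewrite hE addnK.
have -> : (g + 2 - 1 = g + 1)%N by lia.
by apply/eqP; lia.
Qed.

Let c : C := h%:R / 2.
Let kE : k%:R = c * (h%:R - 1).
Proof.
have [_ kk _] := skew_mx_params.
have : k%:R * 2 = h%:R * (h%:R - 1) :> C.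
  by rewrite -natrM muln2 kk natrM natrB //; lia.
by rewrite /c => kk2; rewrite mulrAC -kk2 mulfK ?pnatr_eq0.
Qed.
Let lE : lambda%:R = c * (c - 1).
Proof.
have [_ _ ll] := skew_mx_params.
have : 4 * lambda%:R = h%:R * (h%:R - 2) :> C.
  by rewrite -natrM ll natrM natrB //; lia.
rewrite /c => ll2; apply: (@mulfI _ 4); rewrite ?pnatr_eq0 //.
by rewrite ll2; field.
Qed.
Let hE : h%:R = 2 * c. Proof. by rewrite /c; field. Qed.
Let nE : n%:R = (2 * c) ^+ 2.
Proof. by have [nh _ _] := skew_mx_params; rewrite -hE -natrX -nh. Qed.
Let c0 : c != 0.
Proof. by rewrite mulf_neq0 ?invr_eq0 ?pnatr_eq0 //; lia. Qed.
Let orderE : k%:R - lambda%:R = c ^+ 2. Proof. rewrite kE lE hE; ring. Qed.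

(** The relation for [M *m M^T] exhibits a right inverse of [M], namely a
combination of [M^T] and [J]; a right inverse is also a left inverse. *)
Lemma skew_mx_normal : M^T *m M = M *m M^T.
Proof.
have kn0 : k%:R != 0 :> C by rewrite pnatr_eq0; lia.
(* [k - lambda = c ^+ 2], and [M *m J = k *: J] cancels the term in [J]. *)
pose M' := c ^- 2 *: (M^T - (lambda%:R / k%:R) *: J).
have MM' : M *m M' = 1%:M.
  rewrite /M' -scalemxAr mulmxBr -scalemxAr (rsm_diff MNJ) (rsm_MJ MNJ).
  rewrite scalerA divfK // addrK orderE scale_scalar_mx mulVf //.
  by rewrite expf_neq0.
have := mulmx1C MM'; rewrite -MM' /M' -scalemxAl -scalemxAr.
move/(scalerI (invr_neq0 (expf_neq0 2 c0))).
by rewrite mulmxBl mulmxBr -scalemxAl -scalemxAr (rsm_MJ MNJ) (rsm_JM MNJ) => /addIr.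
Qed.

Lemma skew_mx_comm : M *m N = N *m M.
Proof.
have -> : N = J - (M + M^T) by rewrite {1}(rsm_sum MNJ) addrC addKr.
rewrite mulmxBr mulmxBl mulmxDr mulmxDl skew_mx_normal.
by rewrite (rsm_MJ MNJ) (rsm_JM MNJ).
Qed.

(** In terms of sets: [D] meets every coset of [H] other than [H] in [c] points.
The deviation [X] from this is real, [X *m J = 0] and [X *m N] is a multiple
of [X], so [X *m X^T] reduces to a combination of [N] and [J]; its
coefficients vanish for the values of the parameters found above. *)
Lemma skew_mx_MN : M *m N = c *: (J - N).
Proof.
pose X := M *m N + c *: N - c *: J.
have XJ : X *m J = 0.
  rewrite /X mulmxBl mulmxDl -mulmxA -!scalemxAl (rsm_NJ MNJ) (rsm_JJ MNJ).
  rewrite -scalemxAr (rsm_MJ MNJ) !scalerA -scalerDl -scalerBl.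
  rewrite nE kE hE.
  by apply/matrixP=> i j; rewrite !mxE; ring.
have XN : X *m N = h%:R *: X.
  rewrite /X mulmxBl mulmxDl -mulmxA -!scalemxAl (rsm_NN MNJ) (rsm_JN MNJ).
  by rewrite -scalemxAr; apply/matrixP=> i j; rewrite !mxE; ring.
have XMt : X *m M^T
    = c ^+ 2 *: N + (lambda%:R * h%:R) *: J + c *: (N *m M^T) - (c * k%:R) *: J.
  rewrite /X mulmxBl mulmxDl skew_mx_comm -mulmxA (rsm_diff MNJ) orderE.
  rewrite mulmxDr mul_mx_scalar -!scalemxAl -scalemxAr (rsm_NJ MNJ).
  by rewrite JMt !scalerA.
have NMt : N *m M^T = h%:R *: J - N *m M - h%:R *: N.
  rewrite -(rsm_NJ MNJ) {1}(rsm_sum MNJ) !mulmxDr (rsm_NN MNJ) addrAC addrK.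
  by rewrite addrC addKr.
have trX : X^T = N *m M^T + c *: N - c *: J.
  by rewrite /X linearB linearD !linearZ /= trmx_mul (rsm_trJ MNJ) (rsm_trN MNJ).
have c_real : c \is Num.real by rewrite rpred_div ?realn.
suff : X = 0.
  by move/eqP; rewrite /X -addrA addr_eq0 opprB -scalerBr => /eqP.
apply: (trmx_sqr_eq0 (X := X)).
  have Mreal := rsm_M_real MNJ; have Nreal := rsm_N_real MNJ => i j.
  have Jreal : J i j \is Num.real by rewrite (rsm_sum MNJ) !mxE !rpredD.
  rewrite !mxE; apply: rpredB (rpredM c_real Jreal).
  apply: rpredD (rpredM c_real (Nreal i j)).
  by apply: rpred_sum => l _; rewrite rpredM.
rewrite trX mulmxBr mulmxDr mulmxA XN -!scalemxAr -scalemxAl XJ XN XMt NMt /X.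
rewrite skew_mx_comm kE lE hE.
by apply/matrixP=> i j; rewrite !mxE; ring.
Qed.

(** Adding [M *m M^T] to the square of [M] produces [M *m (J - N)], a combination
of [J] and [N], which [M + c] sends to a multiple of [J]. *)
Lemma skew_mx_annihilator :
  (M - k%:R%:M) *m ((M + c%:M) *m (M *m M + (c ^+ 2)%:M)) = 0.
Proof.
have MM : M *m M + (c ^+ 2)%:M = (c ^+ 2 - c) *: J + c *: N.
  have -> : (c ^+ 2)%:M = M *m M^T - lambda%:R *: J.
    by rewrite (rsm_diff MNJ) addrK orderE.
  rewrite addrA -mulmxDr.
  have -> : M + M^T = J - N by rewrite {1}(rsm_sum MNJ) addrK.
  rewrite mulmxBr skew_mx_MN (rsm_MJ MNJ) kE lE hE.
  by apply/matrixP=> i j; rewrite !mxE; ring.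
have [a ->] : exists a, (M + c%:M) *m (M *m M + (c ^+ 2)%:M) = a *: J.
  exists ((c ^+ 2 - c) * k%:R + c * c + c * (c ^+ 2 - c)).
  rewrite MM mulmxDr !mulmxDl !mul_scalar_mx -!scalemxAr (rsm_MJ MNJ) skew_mx_MN.
  by apply/matrixP=> i j; rewrite !mxE; ring.
by rewrite -scalemxAr mulmxBl mul_scalar_mx (rsm_MJ MNJ) subrr scaler0.
Qed.

End RelativeSkewMatrices.

(** * Traces and multiplicities of a diagonalizable matrix *)

Lemma char_poly_similar (F : fieldType) (n : nat) (P A B : 'M[F]_n) :
  P \in unitmx -> P *m A = B *m P -> char_poly A = char_poly B.
Proof.
move=> Pu PAB.
have detP : \det (map_mx polyC P) \is a GRing.unit.
  by rewrite det_map_mx rmorph_unit // -unitmxE.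
apply: (mulrI detP); rewrite /char_poly -det_mulmx mulrC -det_mulmx.
congr (\det _); rewrite /char_poly_mx mulmxBr mulmxBl.
by rewrite -!map_mxM PAB mul_scalar_mx mul_mx_scalar.
Qed.

(** A matrix annihilated by a product of distinct linear factors is
diagonalizable, and for a diagonal matrix both sides sum the values of [q] over
the diagonal entries. *)
Lemma mxtrace_horner_mup (F : fieldType) (n : nat) (M : 'M[F]_n.+1) (s : seq F) :
    uniq s -> horner_mx M (\prod_(a <- s) ('X - a%:P)) = 0 ->
  forall q, \tr (horner_mx M q) = \sum_(a <- s) q.[a] * (mup a (char_poly M))%:R.
Proof.
move=> s_uniq /mxminpoly_min Ms q.
have [P Pu /similar_diagPex[d PMd]] :
  exists2 P, P \in unitmx & similar_diag P M by apply/diagonalizableP; exists s.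
have PM : P *m M = diag_mx d *m P by apply/(similarP Pu).
have char_M : char_poly M = \prod_(a <- [seq d 0 i | i : 'I_n.+1]) ('X - a%:P).
  rewrite (char_poly_similar Pu PM) char_poly_trig ?diag_mx_is_trig //.
  by rewrite big_map big_enum; apply: eq_bigr => i _; rewrite mxE eqxx.
have trE : \tr (horner_mx M q) = \sum_i q.[d 0 i].
  have <- : \tr (horner_mx (diag_mx d) q) = \sum_i q.[d 0 i].
    by rewrite horner_mx_diag mxtrace_diag; apply: eq_bigr => i _; rewrite mxE.
  rewrite -(eqP PMd) conjumx // horner_mx_uconj // mxtrace_mulC.
  by rewrite mulmxA mulVmx // mul1mx.
have ds i : d 0 i \in s.
  rewrite -root_prod_XsubC; apply: root_dvdp Ms _.
  by rewrite root_mxminpoly char_M root_prod_XsubC map_f ?mem_enum.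
have q_split i : q.[d 0 i] = \sum_(a <- s) q.[a] *+ (d 0 i == a).
  rewrite (bigD1_seq (d 0 i)) //= eqxx big1 ?addr0 // => a.
  by rewrite eq_sym => /negPf->.
rewrite trE (eq_bigr _ (fun i _ => q_split i)) exchange_big /=.
apply: eq_bigr => a _; rewrite char_M mu_prod_XsubC mulr_natr sumrMnr.
by rewrite -sum1_count big_map big_enum_cond [in RHS]big_mkcond.
Qed.

Lemma mxminpoly_uniq_roots (F : fieldType) (n : nat) (M : 'M[F]_n.+1) (s : seq F) :
    uniq s -> horner_mx M (\prod_(a <- s) ('X - a%:P)) = 0 ->
    (forall a, a \in s -> (0 < mup a (char_poly M))%N) ->
  mxminpoly M = \prod_(a <- s) ('X - a%:P).
Proof.
move=> s_uniq Ms s_mup; apply/eqP.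
rewrite -eqp_monic ?mxminpoly_monic ?monic_prod_XsubC // /eqp mxminpoly_min //=.
apply: uniq_roots_dvdp; last by rewrite uniq_rootsE.
apply/allP => a /s_mup; rewrite -XsubC_dvd ?monic_neq0 ?char_poly_monic //.
by rewrite dvdp_XsubCl root_mxminpoly.
Qed.

(** The imaginary part of the first moment makes the multiplicities of [ic] and
[-ic] equal, its real part gives [m (- c) = (h - 1) m k], and the second moment
then gives [2 m (ic) = h (h - 1) m k]; the total [h^2] forces [m k = 1]. *)
Lemma multiplicities (C : numClosedFieldType) (c : C) (h : nat) (m : C -> nat) :
  let k := c * (h%:R - 1) in let s := [:: k; - c; 'i * c; - ('i * c)] in
  0 < c -> (1 < h)%N ->
  \sum_(a <- s) (m a)%:R = (h ^ 2)%:R :> C ->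
  \sum_(a <- s) a * (m a)%:R = 0 -> \sum_(a <- s) a ^+ 2 * (m a)%:R = 0 ->
  [/\ m k = 1%N, m (- c) = (h - 1)%N, m ('i * c) = (h * (h - 1) %/ 2)%N
    & m (- ('i * c)) = (h * (h - 1) %/ 2)%N].
Proof.
move=> k s c_gt0 h1; rewrite !big_cons !big_nil !addr0.
move: (m k) (m (- c)) (m ('i * c)) (m (- ('i * c))) => m0 m1 m2 m3 {m s}.
rewrite -!natrD => /eqP; rewrite eqr_nat => /eqP sum_m tr1 tr2.
have c0 : c != 0 by rewrite gt_eqF.
have creal : c \is Num.real by rewrite gtr0_real.
have kreal : k \is Num.real by rewrite rpredM ?rpredB ?realn ?real1.
have {}tr1 : (k * m0%:R - c * m1%:R) + 'i * (c * (m2%:R - m3%:R)) = 0.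
  by rewrite -[RHS]tr1; ring.
have r1 : k * m0%:R - c * m1%:R \is Num.real by rewrite rpredB // rpredM // realn.
have r2 : c * (m2%:R - m3%:R) \is Num.real by rewrite rpredM ?rpredB ?realn.
have /eqP := congr1 (fun z => 'Im z) tr1; have /eqP := congr1 (fun z => 'Re z) tr1.
rewrite Re_rect // Im_rect // !raddf0 => /eqP re.
rewrite mulf_eq0 (negPf c0) subr_eq0 eqr_nat => /eqP m23; subst m3.
have {re} m1E : (m1 + m0 = h * m0)%N.
  move: re => /eqP; rewrite /k -mulrA -mulrBr mulf_eq0 (negPf c0) /= => /eqP re.
  apply/eqP; rewrite -(eqr_nat C) natrD natrM -subr_eq0 -oppr_eq0 -re.
  by apply/eqP; ring.
have ic_sqr : ('i * c) ^+ 2 = - c ^+ 2 by rewrite exprMn sqrCi mulN1r.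
have {tr2} m2E : ((h - 1) * (h - 1) * m0 + m1 = 2 * m2)%N.
  apply/eqP; rewrite -(eqr_nat C) natrD !natrM natrB; last lia.
  rewrite -subr_eq0 -(mulrI_eq0 _ (mulfI (expf_neq0 2 c0))) -[X in _ == X]tr2.
  by rewrite /k !sqrrN ic_sqr; apply/eqP; ring.
have m0E : m0 = 1%N by nia.
subst m0.
have m2E' : (2 * m2 = h * (h - 1))%N by nia.
by split; lia.
Qed.

(** * The spectrum of a relative skew Hadamard difference set *)

Unset Implicit Arguments.

Theorem theorem1p4 (C : numClosedFieldType) (gT : finGroupType)
    (G H : {group gT}) (D : {set gT}) (v k lambda : nat) :
  relative_skew_hadamard v k lambda G D H -> D != set0 ->
  let h := #|H| in
  let M := regular_sum_mx C G D in
  [/\ mxminpoly M = ('X - (k%:R)%:P) * ('X + (h%:R / 2)%:P)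
                      * ('X^2 + (h%:R ^+ 2 / 4)%:P),
      forall a : C, eigenvalue M a =
        (a \in [:: k%:R; - (h%:R / 2); 'i * h%:R / 2; - ('i * h%:R / 2)])
    & [/\ mup k%:R (char_poly M) = 1%N,
          mup (- (h%:R / 2)) (char_poly M) = (h - 1)%N,
          mup ('i * h%:R / 2) (char_poly M) = (h * (h - 1) %/ 2)%N
        & mup (- ('i * h%:R / 2)) (char_poly M) = (h * (h - 1) %/ 2)%N]].
Proof.
move=> skewD D0 h M.
have [[_ _ Dk _] sHG H1 _ _] := skewD.
have h1 : (1 < h)%N by rewrite cardG_gt1.
have k0 : (0 < k)%N by rewrite -Dk card_gt0.
have hG : (h %| #|G|.-1.+1)%N by rewrite prednK ?cardG_gt0 // cardSg.
have := relative_skew_mx_cast (esym (prednK (cardG_gt0 G)))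
          (relative_skew_gset_mx C skewD).
rewrite -/h -[castmx _ (gset_mx C G D)]/M; move: (castmx _ _) (castmx _ _).
move=> J N MNJ; clearbody h M.
have [nE kE _] := skew_mx_params MNJ (ltn0Sn _) h1 k0 hG.
have Mann := skew_mx_annihilator MNJ (ltn0Sn _) h1 k0 hG.
rewrite -[_ * _ / 2]mulrA.
move: Mann; set c : C := h%:R / 2 => Mann.
have c_gt0 : 0 < c by rewrite divr_gt0 ?ltr0n //; lia.
have kc : k%:R = c * (h%:R - 1).
  have k2 : k%:R * 2 = h%:R * (h%:R - 1) :> C.
    by rewrite -natrM muln2 kE natrM natrB //; lia.
  by rewrite /c mulrAC -k2 mulfK ?pnatr_eq0.
have c2E : h%:R ^+ 2 / 4 = c ^+ 2 by rewrite /c; field.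
(* With [h / 2] visible, the morphism lemmas below would split [c] itself. *)
clearbody c; pose s := [:: k%:R; - c; 'i * c; - ('i * c)].
(* The roots [k] and [-c] have positive squares, the other two a negative one. *)
have s_uniq : uniq s.
  have sqr_neq (x y : C) : 0 < x ^+ 2 -> y ^+ 2 < 0 -> x != y.
    by move=> x0 y0; apply: contraTneq x0 => ->; rewrite lt_gtF.
  have ic2 : ('i * c) ^+ 2 < 0 by rewrite exprMn sqrCi mulN1r oppr_lt0 exprn_gt0.
  have k2 : 0 < k%:R ^+ 2 :> C by rewrite exprn_gt0 ?ltr0n.
  have c2 : 0 < (- c) ^+ 2 by rewrite sqrrN exprn_gt0.
  have k_neq_c : k%:R != - c by rewrite gt_eqF // (lt_trans (y := 0)) ?oppr_lt0 ?ltr0n.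
  have ic_neq : 'i * c != - ('i * c).
    by rewrite -addr_eq0 -mulr2n mulrn_eq0 /= mulf_neq0 ?neq0Ci ?gt_eqF.
  by rewrite /= !inE !negb_or k_neq_c ic_neq !sqr_neq // sqrrN.
have prod_s : \prod_(a <- s) ('X - a%:P)
    = ('X - (k%:R)%:P) * ('X + c%:P) * ('X^2 + (h%:R ^+ 2 / 4)%:P).
  have -> : h%:R ^+ 2 / 4 = - ('i * c) ^+ 2.
    by rewrite exprMn sqrCi mulN1r opprK.
  by rewrite !big_cons big_nil !polyCN polyC_exp; ring.
have Ms : horner_mx M (\prod_(a <- s) ('X - a%:P)) = 0.
  rewrite prod_s c2E -mulrA 2!rmorphM rmorphB 2!rmorphD /=.
  rewrite rmorphXn /= horner_mx_X !horner_mx_C.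
  exact: Mann.
have mups : [/\ mup k%:R (char_poly M) = 1%N,
     mup (- c) (char_poly M) = (h - 1)%N,
     mup ('i * c) (char_poly M) = (h * (h - 1) %/ 2)%N
   & mup (- ('i * c)) (char_poly M) = (h * (h - 1) %/ 2)%N].
  have trM := mxtrace_horner_mup s_uniq Ms.
  have count := @multiplicities C c h (fun a => mup a (char_poly M)) c_gt0 h1.
  rewrite -kc -/s in count; apply: count.
  - have tr1 : \tr (horner_mx M 1) = (h ^ 2)%:R.
      by rewrite rmorph1 mxtrace1; congr (_%:R).
    rewrite -tr1 trM.
    by apply: eq_bigr => a _; rewrite hornerC mul1r.
  - have trX : \tr (horner_mx M 'X) = 0 by rewrite horner_mx_X (rsm_trace MNJ).
    rewrite -[RHS]trX trM.
    by apply: eq_bigr => a _; rewrite hornerX.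
  have trX2 : \tr (horner_mx M ('X ^+ 2)) = 0.
    by rewrite rmorphXn /= horner_mx_X expr2 (rsm_trace_sqr MNJ).
  rewrite -[RHS]trX2 trM.
  by apply: eq_bigr => a _; rewrite hornerXn.
have minM : mxminpoly M = \prod_(a <- s) ('X - a%:P).
  apply: mxminpoly_uniq_roots => // a; rewrite !inE.
  have [m0 m1 m2 m3] := mups.
  have h2 : (0 < h * (h - 1) %/ 2)%N by rewrite divn_gt0 //; nia.
  by case/or4P=> /eqP->; rewrite ?m0 ?m1 ?m2 ?m3 // subn_gt0.
split=> // [|a]; first by rewrite minM.
by rewrite eigenvalue_root_char -root_mxminpoly minM root_prod_XsubC.
Qed.
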